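(* Let $d\ge2$ and $n\ge1$ be integers. A prime $p$ divides $D_d(0,n)$ if and only if the map $R_d:\mathbb{A}^3\to\mathbb{A}^3$, $$R_d(x,y,z)=(y,\; y^d+y-x^d,\; d\,x^{d-1}z+1),$$ has a periodic point over $\overline{\mathbb{F}_p}$ of the form $(0,c,0)$, $c\in\overline{\mathbb{F}_p}$, with minimal period $n$.
   Context: Let $f_{d,c}(z)=z^d+c$, with $f_{d,c}^k$ its $k$-th iterate, and let $\mu$ be the Möbius function. $G_d(0,n)=\prod_{k\mid n}\left(f_{d,c}^k(0)\right)^{\mu(n/k)}$, a polynomial in $c$ with integer coefficients, and $D_d(0,n)=\operatorname{Disc}(G_d(0,n))$ is its discriminant as a polynomial in $c$ (the discriminant of a degree one polynomial being $1$). *)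

(* Defs.v *)
From HB Require Import structures.
From mathcomp Require Import all_boot all_order all_algebra all_field.
From mathcomp Require Import ring.

Set Implicit Arguments.
Unset Strict Implicit.
Unset Printing Implicit Defensive.

Import Order.TTheory GRing.Theory Num.Theory.
Local Open Scope ring_scope.

Definition mobius (n : nat) : int :=
  if all (fun p => logn p n == 1%N) (primes n)
  then (-1) ^+ size (primes n) else 0.

Definition fdc (R : nzRingType) (d : nat) (c z : R) : R := z ^+ d + c.

(* The iterate f_{d,c}^k(0), with the parameter c as the indeterminate. *)
Definition crit_iter (d k : nat) : {poly int} :=
  iter k (fdc d 'X) 0.

Definition Gfrac (d n : nat) : {fraction {poly int}} :=
  \prod_(k <- divisors n) tofrac (crit_iter d k) ^ mobius (n %/ k).

Definition Gnum (d n : nat) : {poly int} :=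
  \prod_(k <- divisors n | mobius (n %/ k) == 1) crit_iter d k.
Definition Gden (d n : nat) : {poly int} :=
  \prod_(k <- divisors n | mobius (n %/ k) == -1) crit_iter d k.

(* The product Gfrac as an element of {poly int}; the division is exact by
   GpolyE below. *)
Definition Gpoly (d n : nat) : {poly int} := Gnum d n %/ Gden d n.

(* Disc P = (-1)^(m(m-1)/2) Res(P, P') / lc(P) with m = deg P; the division by
   the leading coefficient is exact.  The resultant of mxpoly lists coefficients
   by increasing degree, which multiplies the usual Res(P, P') by
   (-1)^(m(m-1)) = 1. *)
Definition Disc (P : {poly int}) : int :=
  ((-1) ^+ 'C((size P).-1, 2) * resultant P P^`() %/ lead_coef P)%Z.

Definition Ddisc (d n : nat) : int := Disc (Gpoly d n).

Definition Rmap (K : nzRingType) (d : nat) (v : K * K * K) : K * K * K :=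
  let: (x, y, z) := v in
  (y, y ^+ d + y - x ^+ d, d%:R * x ^+ d.-1 * z + 1).

Definition has_minimal_period (T : Type) (f : T -> T) (x : T) (n : nat) : Prop :=
  [/\ (0 < n)%N, iter n f x = x
    & forall m, (0 < m < n)%N -> iter m f x <> x].

Lemma Disc_deg1 (a b : int) : a != 0 -> Disc (a *: 'X + b%:P) = 1.
Proof.
move=> a0; have sP : size (a *: 'X + b%:P) = 2%N.
  rewrite size_polyDl ?size_scale ?size_polyX //.
  exact: leq_ltn_trans (size_polyC_leq1 _) _.
have dP : (a *: 'X + b%:P)^`() = a%:P.
  by rewrite derivD derivZ derivX derivC addr0 alg_polyC.
have lP : lead_coef (a *: 'X + b%:P) = a.
  by rewrite lead_coefE sP /= coefD coefZ coefX coefC mulr1 addr0.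
rewrite /Disc lP; suff -> : resultant (a *: 'X + b%:P) (a *: 'X + b%:P)^`() = a.
  by rewrite sP expr0 mul1r divzz a0.
have HM := @Sylvester_mxE int (a *: 'X + b%:P) a%:P.
rewrite dP /resultant; move: (Sylvester_mx _ _) HM; rewrite sP size_polyC a0 /= => M HM.
rewrite (det_mx11 M) HM.
case: (split _) => -[j Hj] /=; first by [].
by move: Hj; case: j => // _; rewrite coefC.
Qed.

Lemma mobius_sqr p j : prime p -> (0 < j)%N -> (p ^ 2 %| j)%N -> mobius j = 0.
Proof.
move=> pp j0 pj; rewrite /mobius ifF //; apply/negbTE/allPn; exists p.
  by rewrite mem_primes pp j0 (dvdn_trans _ pj) ?dvdn_exp.
by move: pj; rewrite pfactor_dvdn //; case: eqP => [->|].
Qed.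

Lemma mobius_mulp p j :
  prime p -> (0 < j)%N -> ~~ (p %| j)%N -> mobius (p * j) = - mobius j.
Proof.
move=> pp j0 npj; have p0 := prime_gt0 pp.
have pjp : p \notin primes j by rewrite mem_primes pp j0.
have pe : perm_eq (primes (p * j)) (p :: primes j).
  apply: uniq_perm; rewrite ?primes_uniq //= ?pjp ?primes_uniq //.
  by move=> q; rewrite primesM // primes_prime // !inE.
rewrite /mobius (perm_all _ pe) (perm_size pe) /=.
rewrite lognM // logn_prime // eqxx.
have -> : logn p j = 0%N by apply/eqP; rewrite -leqn0 leqNgt logn_gt0.
rewrite /=.
have -> : all (fun q => logn q (p * j) == 1%N) (primes j)
        = all (fun q => logn q j == 1%N) (primes j).
  apply: eq_in_all => q qj; rewrite lognM // logn_prime //.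
  case: (q =P p) => [e|_] //; by rewrite -e qj in pjp.
by case: ifP; rewrite ?oppr0 // exprS mulN1r.
Qed.

Lemma mobius_sum n : (1 < n)%N -> \sum_(j <- divisors n) mobius j = 0.
Proof.
move=> n1; have n0 := ltnW n1.
set p := pdiv n; have pp : prime p by apply: pdiv_prime.
have p0 := prime_gt0 pp; have pn : (p %| n)%N by apply: pdiv_dvd.
set A := [seq j <- divisors n | ~~ (p %| j)%N].
pose B := [seq (p * j)%N | j <- A].
have memA j : (j \in A) = ~~ (p %| j)%N && (j %| n)%N.
  by rewrite mem_filter -dvdn_divisors.
have uB : uniq B.
  rewrite map_inj_in_uniq ?filter_uniq ?divisors_uniq // => x y _ _ /eqP.
  by rewrite eqn_pmul2l // => /eqP.
rewrite (bigID (fun j => j \in B)) /= (bigID (fun j => (p %| j)%N) [predC B]) /=.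
have -> : \sum_(j <- divisors n | j \in B) mobius j = \sum_(j <- B) mobius j.
  rewrite -big_filter; apply: perm_big; apply: uniq_perm => //.
    by rewrite filter_uniq ?divisors_uniq.
  move=> x; rewrite mem_filter; case: (boolP (x \in B)) => //=.
  case/mapP=> j; rewrite memA -dvdn_divisors // => /andP[npj jn] ->.
  by rewrite Gauss_dvd ?pn ?jn // prime_coprime.
have -> : \sum_(j <- divisors n | (j \notin B) && (p %| j)%N) mobius j = 0.
  rewrite big_seq_cond big1 // => x; rewrite -dvdn_divisors //.
  case/and3P=> xn xB /dvdnP[j xE].
  have x0 := dvdn_gt0 n0 xn.
  apply: (mobius_sqr pp) => //; rewrite xE expnS expn1 dvdn_pmul2r //.
  apply: contraR xB => npj; apply/mapP; exists j; last by rewrite mulnC.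
  by rewrite memA npj (dvdn_trans _ xn) // xE dvdn_mulr.
rewrite add0r big_map.
have -> : \sum_(j <- divisors n | (j \notin B) && ~~ (p %| j)%N) mobius j
        = \sum_(j <- A) mobius j.
  rewrite [RHS]big_filter; apply: eq_bigl => x.
  case: (boolP (p %| x)%N) => px; rewrite ?andbF ?andbT //.
  by apply/mapP=> -[j _ xE]; rewrite xE dvdn_mulr in px.
rewrite -big_split /= big_seq big1 // => j.
rewrite memA => /andP[npj jn].
by rewrite mobius_mulp ?addNr // (dvdn_gt0 n0).
Qed.

Lemma mobius_sum_ge0 n : (0 < n)%N -> 0 <= \sum_(j <- divisors n) mobius j.
Proof.
case: n => [|[|n]] // _; last by rewrite mobius_sum.
by rewrite (_ : divisors 1 = [:: 1%N]) // big_seq1.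
Qed.

Lemma mobius_cases n : [\/ mobius n = 1, mobius n = -1 | mobius n = 0].
Proof.
rewrite /mobius; case: ifP => _; last by constructor 3.
by rewrite -signr_odd; case: odd; [constructor 2|constructor 1].
Qed.
Lemma iter_fdc_expand (R : comNzRingType) d (c : R) k z : (1 < d)%N ->
  exists q, iter k.+1 (fdc d c) z = iter k.+1 (fdc d c) 0 + z ^+ 2 * q.
Proof.
move=> d1; elim: k => [|k [q IH]].
  exists (z ^+ d.-2); rewrite /= /fdc expr0n gtn_eqF ?(ltnW d1) // add0r.
  by rewrite addrC -exprD -[(2 + _)%N]/(d.-2.+2) -[in LHS](subnK d1) addn2 subn2.
rewrite iterS IH [iter k.+2 _ 0]iterS /fdc.
set A := iter k.+1 _ 0.
have := subrXX (A + z ^+ 2 * q) A d; set S := \sum_(i < d) _.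
rewrite [_ - A]addrC addrA addNr add0r => /eqP; rewrite subr_eq => /eqP ->.
by exists (q * S); ring.
Qed.

Lemma crit_iter_monic d k : (1 < d)%N ->
  crit_iter d k.+1 \is monic /\ (1 < size (crit_iter d k.+1))%N.
Proof.
move=> d1; elim: k => [|k [/monicP lk sk]].
  rewrite /crit_iter /= /fdc expr0n gtn_eqF ?(ltnW d1) // add0r.
  by rewrite monicX size_polyX.
rewrite /crit_iter iterS -/(crit_iter d k.+1) /fdc.
have sX : (size ('X : {poly int}) < size (crit_iter d k.+1 ^+ d))%N.
  have -> : size (crit_iter d k.+1 ^+ d) = ((size (crit_iter d k.+1)).-1 * d).+1.
    by rewrite -size_exp prednK // size_poly_gt0 expf_neq0 // -size_poly_gt0 ltnW.
  rewrite size_polyX ltnS (leq_trans d1) // leq_pmull // -ltnS prednK // ltnW //.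
rewrite size_polyDl //; split; last by rewrite (leq_trans _ sX) // size_polyX.
by apply/monicP; rewrite lead_coefDl // lead_coef_exp lk expr1n.
Qed.

Section MupCrit.
Variables (K : fieldType) (d : nat) (x : K).
Hypothesis d1 : (1 < d)%N.
Let a k : {poly K} := iter k (fdc d 'X) 0.
Hypothesis a_neq0 : forall k, a k.+1 != 0.

Lemma mup_crit_iter m : (0 < m)%N -> root (a m) x ->
  (forall r, (0 < r < m)%N -> ~~ root (a r) x) ->
  forall k, (0 < k)%N ->
    mup x (a k) = if (m %| k)%N then mup x (a m) else 0%N.
Proof.
move=> m0 rm minm.
have am0 : a m != 0 by case: m m0 {rm minm}.
have e0 : (0 < mup x (a m))%N by rewrite -XsubC_dvd // -root_factor_theorem.
set e := mup x (a m) in e0 *.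
have Xe : ('X - x%:P) ^+ e.+1 %| a m ^+ 2.
  apply: (@dvdp_trans _ (('X - x%:P) ^+ (e * 2))).
    by rewrite dvdp_exp2l // muln2 -addnn -addn1 leq_add2l.
  by rewrite exprM dvdp_exp2r // -mup_geq.
elim/ltn_ind => k IH k0; case: (ltngtP k m) => [km|mk|->].
- rewrite gtnNdvd //; apply: mupNroot; apply: minm; exact/andP.
- have km0 : (0 < k - m)%N by rewrite subn_gt0.
  have {IH} := IH (k - m)%N; rewrite ltn_subrL m0 k0 => /(_ isT km0).
  have -> : (m %| k - m)%N = (m %| k)%N by rewrite dvdn_subl // ltnW.
  move=> IH; rewrite -IH.
  have ak0 : a k != 0 by case: k k0 {mk km0 IH}.
  have akm0 : a (k - m)%N != 0 by case: (k - m)%N km0 {IH}.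
  have le : (mup x (a (k - m)%N) <= e)%N by rewrite IH; case: ifP.
  have [q aE] : exists q, a k = a (k - m)%N + a m ^+ 2 * q.
    have [q] := @iter_fdc_expand _ d ('X : {poly K}) (k - m).-1 (a m) d1.
    rewrite prednK // => aE; exists q.
    by rewrite -aE /a -iterD subnK // ltnW.
  have dvd j : (j <= e.+1)%N ->
      (('X - x%:P) ^+ j %| a k) = (('X - x%:P) ^+ j %| a (k - m)%N).
    move=> je; rewrite aE dvdp_addl // dvdp_mulr //.
    by apply: dvdp_trans Xe; rewrite dvdp_exp2l.
  apply/eqP; rewrite eqn_leq mup_leq // mup_geq // !dvd ?(leq_trans le) //.
  by rewrite -mup_leq // -mup_geq // !leqnn.
- by rewrite dvdnn.
Qed.

Lemma mup_crit_prod n : (0 < n)%N ->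
  (mup x (\prod_(k <- divisors n | mobius (n %/ k) == (-1)%R) a k) <=
   mup x (\prod_(k <- divisors n | mobius (n %/ k) == 1%R) a k))%N.
Proof.
move=> n0.
have div0 k : k \in divisors n -> (0 < k)%N.
  by rewrite -dvdn_divisors //; apply: dvdn_gt0.
have an0 k : k \in divisors n -> a k != 0 by move/div0; case: k.
have mupP (P : pred nat) s : {subset s <= divisors n} ->
    (\prod_(k <- s | P k) a k != 0) /\
    mup x (\prod_(k <- s | P k) a k) = (\sum_(k <- s | P k) mup x (a k))%N.
  elim: s => [|k s IH] sub.
    by rewrite !big_nil oner_neq0; split=> //; rewrite mupNroot // root1.
  have [p0 pE] := IH (fun j js => sub j (mem_behead (s := k :: s) js)).
  rewrite !big_cons; case: ifP => // _; have k0 := an0 k (sub k (mem_head _ _)).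
  by rewrite mulf_neq0 // mupM // pE.
have mupE' P := proj2 (mupP P _ (fun j js => js)).
rewrite !mupE' {mupP mupE'}.
have [/hasP[m0 m0n rm0]|nr] := boolP (has (fun k => root (a k) x) (divisors n)); last first.
  rewrite big_seq_cond big1 // => k /andP[kn _]; apply: mupNroot.
  by move/hasPn: nr => /(_ k kn).
have ex : exists m, (0 < m)%N && root (a m) x by exists m0; rewrite rm0 div0.
case: (ex_minnP ex) => m /andP[mp rm] minm.
have mupE := @mup_crit_iter m mp rm.
have {mupE} : forall k, (0 < k)%N -> mup x (a k) = if (m %| k)%N then mup x (a m) else 0%N.
  apply: mupE => r /andP[r0 rlt]; apply: contraL rlt => rr.
  by rewrite -leqNgt minm // r0.
set e := mup x (a m) => mupE; rewrite -lez_nat -subr_ge0.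
have -> : (\sum_(k <- divisors n | mobius (n %/ k) == 1%R) mup x (a k))%N%:Z -
          (\sum_(k <- divisors n | mobius (n %/ k) == (-1)%R) mup x (a k))%N%:Z =
          \sum_(k <- divisors n | (m %| k)%N) mobius (n %/ k) * e%:Z.
  rewrite !(big_morph Posz PoszD (erefl (Posz 0))).
  rewrite [X in X - _]big_mkcond [X in _ - X]big_mkcond [RHS]big_mkcond -sumrB.
  rewrite !big_seq; apply: eq_bigr => k /div0 k0; rewrite mupE //.
  case: (mobius_cases (n %/ k)) => ->; case: ifP => _ /=; rewrite ?mul1r ?mulN1r ?mul0r ?subr0 ?sub0r ?oppr0 //.
rewrite -mulr_suml mulr_ge0 //.
have [mn|mn] := boolP (m %| n)%N; last first.
  rewrite big_seq_cond big_pred0 // => k; apply/negbTE/andP => -[].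
  by rewrite -dvdn_divisors // => kn mk; rewrite (dvdn_trans mk kn) in mn.
suff -> : \sum_(k <- divisors n | (m %| k)%N) mobius (n %/ k) =
          \sum_(j <- divisors (n %/ m)) mobius j.
  by apply: mobius_sum_ge0; rewrite divn_gt0 // dvdn_leq.
have nm0 : (0 < n %/ m)%N by rewrite divn_gt0 // dvdn_leq.
have divK k : (k %| n)%N -> (n %/ (n %/ k))%N = k.
  move=> kn; have k0 : (0 < n %/ k)%N 
    by rewrite divn_gt0 ?(dvdn_gt0 n0 kn) // dvdn_leq.
  by apply/eqP; rewrite -(eqn_pmul2r k0) divnK ?dvdn_div // mulnC divnK.
rewrite -big_filter -(big_map (fun k => n %/ k)%N xpredT mobius).
apply: perm_big; apply: uniq_perm; rewrite ?divisors_uniq //.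
  rewrite map_inj_in_uniq ?filter_uniq ?divisors_uniq // => k l.
  rewrite !mem_filter -!dvdn_divisors // => /andP[_ kn] /andP[_ ln] E.
  by rewrite -(divK k) // E divK.
move=> j; rewrite -dvdn_divisors //; apply/mapP/idP => [[k]|jnm].
  rewrite mem_filter -dvdn_divisors // => /andP[mk kn] ->.
  by rewrite dvdn_divRL // -[X in (_ %| X)%N](divnK kn) dvdn_mul.
have jmn : (j * m %| n)%N by rewrite -dvdn_divRL.
have jn : (j %| n)%N by apply: dvdn_trans jmn; rewrite dvdn_mulr.
exists (n %/ j)%N; last by rewrite divK.
by rewrite mem_filter -dvdn_divisors // dvdn_div // dvdn_divRL // mulnC jmn.
Qed.

End MupCrit.

Lemma dvdp_mup (F : closedFieldType) (p q : {poly F}) :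
  p != 0 -> q != 0 -> (forall x, mup x p <= mup x q)%N -> p %| q.
Proof.
move=> p0 q0; have [s ->] := closed_field_poly_normal p.
rewrite dvdpZl ?lead_coef_eq0 // => H.
have {}H x : (count_mem x s <= mup x q)%N.
  apply: leq_trans (H x); rewrite -mu_prod_XsubC.
  have sp0 : \prod_(z <- s) ('X - z%:P) != 0 :> {poly F}.
    by apply: monic_neq0; apply: monic_prod_XsubC.
  rewrite mup_geq ?scaler_eq0 ?lead_coef_eq0 ?negb_or ?p0 //.
  by rewrite dvdpZr ?lead_coef_eq0 // -mup_geq.
elim: s q q0 H {p p0} => [|y s IH] q q0 H; first by rewrite big_nil dvd1p.
have : 'X - y%:P %| q.
  by rewrite XsubC_dvd // (leq_trans _ (H y)) //= eqxx.
case/dvdpP=> r qE; rewrite qE mulf_eq0 negb_or in q0; case/andP: q0 => r0 X0.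
rewrite big_cons qE mulrC dvdp_mul2r //; apply: IH => // x.
move: (H x); rewrite /= qE mupM // -['X - _]expr1 mup_XsubCX addnC.
by case: eqP => _; rewrite ?addn0 // leq_add2r.
Qed.

Lemma crit_prod_monic d n (P : pred nat) : (1 < d)%N -> (0 < n)%N ->
  \prod_(k <- divisors n | P k) crit_iter d k \is monic.
Proof.
move=> d1 n0; rewrite big_seq_cond; apply: monic_prod => k.
rewrite -dvdn_divisors // => /andP[/(dvdn_gt0 n0)]; case: k => // k _ _.
by case: (crit_iter_monic k d1).
Qed.

Lemma map_crit_iter (R : nzRingType) (f : {rmorphism int -> R}) d k :
  map_poly f (crit_iter d k) = iter k (fdc d 'X) 0.
Proof.
elim: k => [|k IH]; first by rewrite /= rmorph0.
by rewrite !iterS -IH /fdc rmorphD rmorphXn /= map_polyX.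
Qed.

Lemma GpolyK d n : (1 < d)%N -> (0 < n)%N -> Gpoly d n * Gden d n = Gnum d n.
Proof.
move=> d1 n0.
have mD : Gden d n \is monic by apply: crit_prod_monic.
have mN : Gnum d n \is monic by apply: crit_prod_monic.
pose f : {rmorphism int -> algC} := intr.
have inj0 p : map_poly f p = 0 -> p = 0.
  have /(_ intr_inj (rmorph0 f)) finj := @map_inj_poly _ _ f.
  by move=> fp0; apply: finj; rewrite fp0 rmorph0.
have := Pdiv.IdomainMonic.divp_eq mD (Gnum d n); rewrite -/(Gpoly d n) => E.
suff R0 : Gnum d n %% Gden d n = 0 by rewrite E R0 addr0.
apply: inj0; apply/eqP; apply: contraT => r0.
have fD : map_poly f (Gden d n) %| map_poly f (Gnum d n).
  apply: dvdp_mup; rewrite ?monic_neq0 ?monic_map // => x.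
  rewrite !rmorph_prod /=.
  under eq_bigr do rewrite map_crit_iter.
  under [X in (_ <= mup x X)%N]eq_bigr do rewrite map_crit_iter.
  apply: mup_crit_prod => // k; rewrite -(map_crit_iter f).
  by rewrite monic_neq0 ?monic_map // (crit_iter_monic k d1).1.
move/(congr1 (map_poly f)): E; rewrite rmorphD rmorphM /= => E.
move: fD; rewrite E dvdp_addr ?dvdp_mull // => /(dvdp_leq r0).
rewrite leqNgt => /negP[].
rewrite [X in (_ < X)%N]size_map_poly_id0; last first.
  by rewrite (monicP mD) rmorph1 oner_neq0.
by apply: leq_ltn_trans (size_poly _ _) _; rewrite ltn_modp monic_neq0.
Qed.

Lemma GpolyE d n : (1 < d)%N -> (0 < n)%N -> tofrac (Gpoly d n) = Gfrac d n.
Proof.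
move=> d1 n0.
have D0 : tofrac (Gden d n) != 0.
  by rewrite tofrac_eq0 monic_neq0 // crit_prod_monic.
apply: (mulIf D0); rewrite -rmorphM GpolyK // /Gfrac /Gnum /Gden !rmorph_prod /=.
rewrite big_mkcond [X in _ * X]big_mkcond -big_split /= !big_seq.
apply: eq_bigr => k; rewrite -dvdn_divisors // => /(dvdn_gt0 n0) k0.
have c0 : tofrac (crit_iter d k) != 0.
  rewrite tofrac_eq0; case: k k0 => // k _.
  by rewrite monic_neq0 // (crit_iter_monic k d1).1.
case: (mobius_cases (n %/ k)) => -> //=; rewrite ?expr1z ?mulr1 ?expr0z ?mulr1 //.
by rewrite exprN1 mulVf.
Qed.

(* Main.v *)
Require Import Defs.
From mathcomp Require Import all_boot all_order all_algebra all_field.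
From mathcomp Require Import ring zify.

(** Write a_k for the polynomial f^k(0) in the parameter c, with coefficients
    reduced to K, and G for the reduction of [Gpoly d n].

    The map R_d is built to compute a_k together with its derivative in c:
    since a_(k+1) = a_k^d + c, the k-th iterate of (0, c, 0) is
    (a_k(c), a_(k+1)(c), a_k'(c)) ([iter_Rmap]).  The orbit is back at its
    starting point at time k > 0 exactly when a_k(c) = a_k'(c) = 0, that is,
    when c is a multiple root of a_k; the middle coordinate then returns to c
    by itself.

    The multiplicities of a point c in the polynomials a_k are very rigid: if m
    is the least positive index with a_m(c) = 0, and e is the multiplicity of c
    in a_m, then c has multiplicity e in a_k when m divides k, and 0 otherwise.
    Indeed f(z) - f(0) = z^d with d > 1, so a_k and a_(k-m) differ by a multiple
    of a_m^2, which vanishes at c to an order greater than e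
    ([mup_crit_iter]).
    Moebius summation leaves multiplicity e in G when m = n, and 0 when m <> n
    ([mup_Gpoly]).  So c is a multiple root of G if and only if m = n and
    e > 1, which is also the condition for (0, c, 0) to have minimal period n
    ([minimal_period_Rmap]): a multiple root of a_k forces m to divide k, and
    it is already a multiple root of a_m.

    It remains to see that p divides the discriminant of the monic integer
    polynomial [Gpoly d n] if and only if its reduction has a multiple root in
    the closed field K ([dvdz_Disc]).  The derivative may lose degree
    modulo p, so the resultant does not simply commute with reduction;
    [resultant_map_eq0] shows that its vanishing still detects common factors,
    because the other polynomial is monic. *)

Set Implicit Arguments.
Unset Strict Implicit.
Unset Printing Implicit Defensive.

Import Order.TTheory GRing.Theory Num.Theory.
Local Open Scope ring_scope.

(** * Resultants under a ring morphism *)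

Section ResultantMap.

Variables (aR : comNzRingType) (F : fieldType) (f : {rmorphism aR -> F}).
Implicit Types p q : {poly aR}.
Local Notation "p ^f" := (map_poly f p).

(** The determinant of the Sylvester matrix vanishes in [F] when the mapped
    matrix has a nonzero row kernel; cutting a kernel vector in two gives the
    coefficients of [u] and [v].  The degree bounds are those
    of [p] and [q], which fix the size of the matrix; the degrees of the images
    may be smaller. *)
Lemma resultant_map_syzygy p q :
  f (resultant p q) = 0 <->
  exists u v : {poly F},
    [/\ (u != 0) || (v != 0), (size u <= (size q).-1)%N,
        (size v <= (size p).-1)%N & u * p^f + v * q^f = 0].
Proof.
pose dp := (size p).-1; pose dq := (size q).-1.
pose band (r : {poly F}) d : 'M[F]_(d, dq + dp) :=
  lin1_mx (poly_rV \o r \o* rVpoly).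
have mapS : map_mx f (Sylvester_mx p q) = col_mx (band p^f dq) (band q^f dp).
  rewrite map_col_mx; congr col_mx;
    by apply: map_lin1_mx => v; rewrite map_poly_rV rmorphM /= map_rVpoly.
have mulS (u : 'rV[F]_dq) (v : 'rV[F]_dp) :
    row_mx u v *m map_mx f (Sylvester_mx p q)
    = poly_rV (rVpoly u * p^f + rVpoly v * q^f).
  by rewrite mapS mul_row_col /band !mul_rV_lin1 /= linearD.
rewrite -det_map_mx; split.
  move/eqP/det0P=> [w w0].
  rewrite -[w]hsubmxK in w0 *; rewrite mulS.
  set u := rVpoly _; set v := rVpoly _ => uv0.
  exists u, v; split; rewrite ?size_poly //.
    rewrite -negb_and; apply: contraNN w0 => /andP[/eqP u0 /eqP v0].
    rewrite -[lsubmx w]rVpolyK -[rsubmx w]rVpolyK -/u -/v u0 v0 !linear0.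
    by rewrite row_mx0.
  move/(congr1 rVpoly): uv0; rewrite linear0 poly_rV_K //.
  rewrite (leq_trans (size_polyD _ _)) // geq_max.
  have le_sz (g : {poly F}) (h : {poly aR}) m :
      (size g <= m)%N -> (size (g * h^f)%R <= m + (size h).-1)%N.
    move=> gm; apply: (leq_trans (size_polyMleq _ _)).
    have := size_poly (size h) (fun i => f h`_i); rewrite -/(map_poly f h).
    by lia.
  rewrite le_sz ?size_poly //= addnC le_sz ?size_poly //.
move=> [u [v [uv0 su sv uv]]]; apply/eqP/det0P.
exists (row_mx (poly_rV u) (poly_rV v)); last first.
  by rewrite mulS !poly_rV_K // uv linear0.
apply: contraTneq uv0; rewrite -[X in _ = X]row_mx0.
case/eq_row_mx=> [/(congr1 rVpoly) u0 /(congr1 rVpoly) v0].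
by move: u0 v0; rewrite !poly_rV_K // !linear0 => -> ->; rewrite eqxx.
Qed.

(** The degree of [q^f] may drop, but that of [p^f] cannot.  If the images are
    coprime, a syzygy [u * p^f + v * q^f = 0] makes [p^f] divide [v], whose size
    is too small, so [v] and then [u] vanish.  Otherwise dividing the two images
    by their gcd gives a nontrivial syzygy. *)
Lemma resultant_map_eq0 p q :
  p \is monic -> (f (resultant p q) == 0) = ~~ coprimep p^f q^f.
Proof.
move=> mp; have mpf : p^f \is monic by apply: monic_map.
have spf : size p^f = size p.
  by rewrite size_map_poly_id0 // (monicP mp) rmorph1 oner_neq0.
have p0 : p^f != 0 by apply: monic_neq0.
apply/eqP/idP => [/resultant_map_syzygy[u [v [uv0 su sv uv]]]|ncop].
  apply: contraL uv0 => cop; rewrite -negb_and negbK.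
  have v0 : v = 0.
    apply/eqP; apply: contraT => v0.
    have : p^f %| v * q^f.
      move/eqP: uv; rewrite addrC addr_eq0 => /eqP ->.
      by rewrite -mulNr dvdp_mull.
    rewrite Gauss_dvdpl // => /(dvdp_leq v0); rewrite spf => /leq_trans/(_ sv).
    by rewrite leqNgt ltn_predL size_poly_gt0 monic_neq0.
  move/eqP: uv; rewrite v0 mul0r addr0 mulf_eq0 (negPf p0) orbF => ->.
  by rewrite eqxx.
apply/resultant_map_syzygy; set g := gcdp p^f q^f.
have g0 : g != 0 by rewrite gcdp_eq0 negb_and p0.
have sg : (1 < size g)%N.
  by move: ncop; rewrite /coprimep -/g ltn_neqAle eq_sym size_poly_gt0 g0 andbT.
have gp : p^f %/ g * g = p^f by apply: divpK; apply: dvdp_gcdl.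
have gq : q^f %/ g * g = q^f by apply: divpK; apply: dvdp_gcdr.
exists (- (q^f %/ g)), (p^f %/ g); split.
- by apply/orP; right; apply: contraNneq p0 => pg0; rewrite -gp pg0 mul0r.
- rewrite size_polyN size_divp //.
  have : (size q^f <= size q)%N by apply: size_poly.
  move: sg; move: (size g) (size q^f) (size q).
  by lia.
- by rewrite size_divp // spf; lia.
- by rewrite -[X in - _ * X + _]gp -[X in _ + _ * X]gq; ring.
Qed.

End ResultantMap.

(** * Discriminants modulo a prime *)

Lemma mup_gt1 (F : fieldType) (P : {poly F}) x :
  P != 0 -> (1 < mup x P)%N = root P x && root P^`() x.
Proof.
move=> P0; rewrite mup_geq //; apply/idP/andP=> [/dvdpP[Q ->]|[]].
  rewrite expr2 mulrA; set S := Q * _.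
  by rewrite !rootE derivM derivXsubC !(hornerE, subrr, mulr0) eqxx.
rewrite -dvdp_XsubCl => /dvdpP[Q ->].
rewrite rootE derivM derivXsubC !hornerE subrr mulr0 add0r -rootE -dvdp_XsubCl.
by move=> XQ; rewrite expr2 dvdp_mul.
Qed.

(** For monic [P] the discriminant is the resultant of [P] and [P^`()] up to
    sign, so it vanishes in [F] when the reductions of [P] and [P^`()] share a
    root. *)
Lemma dvdz_Disc (F : closedFieldType) p (P : {poly int}) :
  p \in [pchar F] -> P \is monic ->
  (p%:Z %| Disc P)%Z <-> exists x : F, (1 < mup x (map_poly intr P))%N.
Proof.
move=> charFp mP; pose f : {rmorphism int -> F} := intr.
rewrite /Disc (monicP mP) divz1 (dvdz_pcharf charFp).
rewrite -/(f _) rmorphM rmorphXn rmorphN1 mulf_eq0 signr_eq0 /=.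
rewrite resultant_map_eq0 // -deriv_map.
have P0 : map_poly f P != 0 by rewrite monic_neq0 ?monic_map.
split=> [/closed_rootP[x]|[x]].
  by rewrite root_gcd -mup_gt1 //; exists x.
by rewrite mup_gt1 // -root_gcd => rx; apply/closed_rootP; exists x.
Qed.

(** * Multiplicities along the critical orbit *)

(** When m divides n, the substitution j = n / k turns the sum into that of the
    Moebius function over the divisors of n / m, which is 0 unless n / m = 1;
    otherwise there is no term. *)
Lemma sum_mobius_multiples n m : (0 < n)%N ->
  \sum_(k <- divisors n | (m %| k)%N) mobius (n %/ k) = (m == n)%:R.
Proof.
move=> n0; have [mn|mn] := boolP (m %| n)%N; last first.
  rewrite big_seq_cond big_pred0 => [|k].
    by case: eqP mn => // ->; rewrite dvdnn.
  apply/negbTE/andP => -[]; rewrite -dvdn_divisors // => kn mk.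
  by rewrite (dvdn_trans mk kn) in mn.
have m0 := dvdn_gt0 n0 mn.
have divn_divn k : (k %| n)%N -> (n %/ (n %/ k))%N = k.
  by move=> kn; rewrite divnA // mulKn.
have nm0 : (0 < n %/ m)%N by rewrite divn_gt0 // dvdn_leq.
have -> : \sum_(k <- divisors n | (m %| k)%N) mobius (n %/ k)
    = \sum_(j <- divisors (n %/ m)) mobius j.
  rewrite -big_filter -(big_map (divn n) xpredT mobius).
  apply: perm_big; apply: uniq_perm; rewrite ?divisors_uniq //.
    rewrite map_inj_in_uniq ?filter_uniq ?divisors_uniq // => k l.
    rewrite !mem_filter -!dvdn_divisors // => /andP[_ kn] /andP[_ ln] E.
    by rewrite -(divn_divn k) // E divn_divn.
  move=> j; rewrite -dvdn_divisors //; apply/mapP/idP => [[k]|jnm].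
    rewrite mem_filter -dvdn_divisors // => /andP[mk kn] ->.
    by rewrite dvdn_divRL // -[X in (_ %| X)%N](divnK kn) dvdn_mul.
  have jn : (j %| n)%N.
    by apply: dvdn_trans jnm _; apply: dvdn_div.
  exists (n %/ j)%N; last by rewrite divn_divn.
  rewrite mem_filter -dvdn_divisors // dvdn_div // dvdn_divRL // mulnC.
  by rewrite -dvdn_divRL // jnm.
have [->|mn_neq] := eqVneq m n.
  by rewrite divnn n0 (_ : divisors 1 = [:: 1%N]) // big_seq1.
rewrite mobius_sum // ltn_neqAle nm0 andbT eq_sym.
by rewrite -(eqn_pmul2r m0) divnK // mul1n eq_sym.
Qed.

Lemma mup_prod (F : fieldType) (I : eqType) (s : seq I) (P : pred I)
    (a : I -> {poly F}) x : {in s, forall i, a i != 0} ->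
  mup x (\prod_(i <- s | P i) a i) = (\sum_(i <- s | P i) mup x (a i))%N.
Proof.
move=> a0; rewrite big_seq_cond [RHS]big_seq_cond.
pose ok (q : {poly F}) k := q != 0 /\ mup x q = k.
suff [] : ok (\prod_(i <- s | (i \in s) && P i) a i)
             (\sum_(i <- s | (i \in s) && P i) mup x (a i))%N by [].
apply: (big_rec2 ok) => [|i k q /andP[/a0 ai0 _] [q0 <-]].
  by split; rewrite ?oner_neq0 // mupNroot // root1.
by split; rewrite ?mulf_neq0 ?mupM.
Qed.

Section CriticalOrbit.

Variables (F : fieldType) (d : nat).
Hypothesis d1 : (1 < d)%N.
Let a k : {poly F} := iter k (fdc d 'X) 0.

Lemma crit_iter_neq0 k : a k.+1 != 0.
Proof.
rewrite /a -(map_crit_iter intr) monic_neq0 ?monic_map //.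
by case: (crit_iter_monic k d1).
Qed.

(** The multiplicity of [x] in [a k] is the constant [mup x (a m)] on the
    multiples of [m] and 0 elsewhere, so the alternating product over the
    divisors of [n] has multiplicity [mup x (a m)] times the sum of
    [mobius (n %/ k)] over the multiples [k] of [m]. *)
Lemma mup_Gpoly x m n : (0 < m)%N -> (0 < n)%N ->
  root (a m) x -> (forall r, (0 < r < m)%N -> ~~ root (a r) x) ->
  mup x (map_poly intr (Gpoly d n)) = ((m == n) * mup x (a m))%N.
Proof.
move=> m0 n0 rm minm.
have mupa := mup_crit_iter d1 crit_iter_neq0 m0 rm minm.
set G := map_poly _ _.
have div0 k : k \in divisors n -> (0 < k)%N.
  by rewrite -dvdn_divisors //; apply: dvdn_gt0.
have an0 : {in divisors n, forall k, a k != 0}.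
  by move=> k /div0; case: k => // k _; apply: crit_iter_neq0.
pose A e := \prod_(k <- divisors n | mobius (n %/ k) == e) a k.
have A0 e : A e != 0.
  rewrite /A big_seq_cond prodf_seq_neq0; apply/allP => k kn.
  by apply/implyP; rewrite an0.
(* [A 1] and [A (-1)] are the reduced numerator and denominator of [Gpoly]. *)
have GA : G * A (-1) = A 1.
  have := congr1 (map_poly (intr : int -> F)) (GpolyK d1 n0).
  rewrite rmorphM !rmorph_prod /=.
  under eq_bigr do rewrite map_crit_iter.
  by under [in X in _ = X -> _]eq_bigr do rewrite map_crit_iter.
have G0 : G != 0 by apply: contraTneq (A0 1) => G0; rewrite -GA G0 mul0r eqxx.
have mupG : (mup x G + mup x (A (-1)%R))%N = mup x (A 1) by rewrite -GA mupM.
apply/eqP; rewrite -eqz_nat; apply/eqP.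
have -> : (mup x G)%:Z = (mup x (A 1))%:Z - (mup x (A (-1)))%:Z.
  by rewrite -mupG PoszD addrK.
rewrite /A !mup_prod // PoszM -[Posz (m == n)]natz.
rewrite -sum_mobius_multiples // mulr_suml.
rewrite !(big_morph Posz PoszD (erefl (Posz 0))).
rewrite [X in X - _]big_mkcond [X in _ - X]big_mkcond [RHS]big_mkcond -sumrB.
rewrite !big_seq; apply: eq_bigr => k /div0 k0; rewrite mupa //.
case: (mobius_cases (n %/ k)) => ->; case: ifP => _ /=;
  by rewrite ?mul1r ?mulN1r ?mul0r ?subr0 ?sub0r ?oppr0.
Qed.

(** The first two coordinates carry consecutive iterates, from which R_d
    recovers c as the difference a_(k+1) - a_k^d; the third one follows the
    chain rule a_(k+1)' = d a_k^(d-1) a_k' + 1. *)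
Lemma iter_Rmap (c : F) k :
  iter k (Rmap d) (0, c, 0) = ((a k).[c], (a k.+1).[c], (a k)^`().[c]).
Proof.
elim: k => [|k IH].
  by rewrite /a /= /fdc expr0n gtn_eqF ?(ltnW d1) // linear0 !hornerE.
have aS j : a j.+1 = a j ^+ d + 'X by [].
have Rmap_triple (x y z : F) : Rmap d (x, y, z) =
  (y, y ^+ d + y - x ^+ d, d%:R * x ^+ d.-1 * z + 1) by [].
rewrite iterS IH Rmap_triple.
(* Only the recurrence between consecutive iterates matters from here on. *)
move: (aS k) (aS k.+1).
move: (a k) (a k.+1) (a k.+2) => A0 A1 A2 A1E ->.
congr (_, _, _).
  rewrite hornerD horner_exp hornerX -addrA; congr (_ + _).
  by rewrite A1E hornerD horner_exp hornerX addrAC subrr add0r.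
rewrite A1E derivD deriv_exp derivX hornerD hornerMn hornerM horner_exp hornerC.
by rewrite -mulrA mulr_natl [A0.[c] ^+ _ * _]mulrC.
Qed.

(** Returning at time [k] means that [c] is a multiple root of [a k].  Either
    side makes [c] a root of some [a k], hence gives a least such index [m], and
    by the rigidity of multiplicities each side says that [m = n] and that [c]
    is a multiple root of [a m]. *)
Lemma minimal_period_Rmap (c : F) n : (0 < n)%N ->
  has_minimal_period (Rmap d) (0, c, 0) n <->
  (1 < mup c (map_poly intr (Gpoly d n)))%N.
Proof.
move=> n0.
have per k : (0 < k)%N -> iter k (Rmap d) (0, c, 0) = (0, c, 0) <->
    (1 < mup c (a k))%N.
  case: k => // k _; rewrite mup_gt1 ?crit_iter_neq0 // iter_Rmap.
  have -> : (a k.+2).[c] = (a k.+1).[c] ^+ d + c.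
    by rewrite [a k.+2]iterS -/(a k.+1) /fdc hornerD horner_exp hornerX.
  split=> [[r _ r']|/andP[/rootP -> /rootP ->]].
    by rewrite !rootE r r' eqxx.
  by rewrite expr0n gtn_eqF ?(ltnW d1) // add0r.
suff main : (exists k, (0 < k)%N && root (a k) c) ->
    has_minimal_period (Rmap d) (0, c, 0) n <->
    (1 < mup c (map_poly intr (Gpoly d n)))%N.
  split=> h; apply/main => //; last first.
    have : root (map_poly intr (Gnum d n)) c.
      rewrite -(GpolyK d1 n0) rmorphM rootM; apply/orP; left.
      by apply: contraTT h => /mupNroot ->.
    rewrite rmorph_prod /root horner_prod prodf_seq_eq0 => /hasP[k].
    rewrite -dvdn_divisors // => /(dvdn_gt0 n0) k0 /andP[_].
    by rewrite /= map_crit_iter => rk; exists k; rewrite k0.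
  exists n; rewrite n0 /=; case: h => _ /(per n n0) h _.
  by apply: contraTT h => /mupNroot ->.
move=> ex; case: (ex_minnP ex) => m /andP[m0 rm] minm0.
have {}minm r : (0 < r < m)%N -> ~~ root (a r) c.
  case/andP=> r0 rlt; apply: contraL rlt => rr.
  by rewrite -leqNgt minm0 // r0.
have mupa := mup_crit_iter d1 crit_iter_neq0 m0 rm minm.
rewrite (mup_Gpoly m0 n0 rm minm); split=> [[_ /(per n n0)]|].
  rewrite mupa //; case: ifP => // mn e1 minn.
  suff /eqP -> : m = n by rewrite mul1n.
  apply/eqP; rewrite eqn_leq dvdn_leq //= leqNgt; apply/negP => mltn.
  apply: (minn m); first by rewrite m0.
  by apply/(per m m0); rewrite mupa // dvdnn.
case: eqVneq => [<-|]; rewrite ?mul1n ?mul0n // => e1; split=> //.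
  exact/per.
move=> k /andP[k0 km] /(per k k0); rewrite mupa //.
by rewrite gtnNdvd.
Qed.

End CriticalOrbit.

(** * Bad primes and periodic points *)

Theorem theorem4p11 (d n p : nat) (hd : (2 <= d)%N) (hn : (1 <= n)%N)
    (hp : prime p) (K : closedFieldType) (iota : {rmorphism 'F_p -> K})
    (hK : integralRange iota) :
  (p%:Z %| Ddisc d n)%Z <->
  exists c : K, has_minimal_period (Rmap d) (0, c, 0) n.
Proof.
have charKp : p \in [pchar K] by rewrite (fmorph_pchar iota) pchar_Fp.
have monicG : Gpoly d n \is monic.
  have monicGden : Gden d n \is monic by apply: crit_prod_monic.
  by rewrite -(monicMr _ monicGden) GpolyK // crit_prod_monic.
rewrite /Ddisc (dvdz_Disc charKp monicG).
by split=> -[c]; exists c; apply/minimal_period_Rmap.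
Qed.
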